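(* Let $n>4$ and let $G=\mathbb W_n$ (where $\mathbb W_n$ is either $\mathbb Z_2^n\rtimes\mathbb S_n$ or its subgroup $K_n\rtimes\mathbb S_n$). Let $\tau\in\mathbb S_n$ with $\tau\neq 1$ be of type $(1^{\lambda_1},2^{\lambda_2},\dots,n^{\lambda_n})$ and let $a\in\mathbb Z_2^n$ be such that $\sigma=(a,\tau)\in G$. If the conjugacy class $\mathcal O_\sigma^G$ is not of type D, then one of the following holds: (i) the type of $\tau$ is $(2,3)$ or $(2^3)$; (ii) the type of $\tau$ is $(2^4)$, $(1,2^2)$, $(1^2,3)$ or $(1^2,2^2)$; (iii) the type of $\tau$ is $(1^{n-2},2)$, or it is $(1^{n-3},3)$ with $n>5$; and in either case $a_i=a_j$ whenever $\tau(i)=i$ and $\tau(j)=j$.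
   Context: $\mathbb S_n$ acts on $\mathbb Z_2^n$ by $\sigma\cdot(a_1,\dots,a_n)=(a_{\sigma^{-1}(1)},\dots,a_{\sigma^{-1}(n)})$. The semidirect product $\mathbb Z_2^n\rtimes\mathbb S_n$ consists of pairs $(a,\sigma)$, also written $a\sigma$, with multiplication $(a,\sigma)(b,\tau)=(a+\sigma\cdot b,\sigma\tau)$. Let $K_n=\{a\in\mathbb Z_2^n\mid a_1+\cdots+a_n=0\}$. $\mathbb W_n$ denotes either $\mathbb Z_2^n\rtimes\mathbb S_n$ or $K_n\rtimes\mathbb S_n$; the result is asserted for both choices. A permutation has type $(1^{\lambda_1},2^{\lambda_2},\dots,n^{\lambda_n})$ if its disjoint cycle decomposition has exactly $\lambda_k$ cycles of length $k$ for each $k$ (fixed points counted as cycles of length 1); entries with $\lambda_k=0$ are omitted and exponents $1$ are omitted. So, for example, $(2,3)$ means $n=5$ with one 2-cycle and one 3-cycle, and $(2^3)$ means $n=6$ with three 2-cycles. A rack is a non-empty set $X$ with an operation $\rhd:X\times X\to X$ such that $x\rhd x=x$, $x\rhd(y\rhd z)=(x\rhd y)\rhd(x\rhd z)$, and $y\mapsto x\rhd y$ is bijective for every $x$. The conjugacy class $\mathcal O_s^G$ of $s$ in a group $G$ is a rack with $x\rhd y=xyx^{-1}$. A subrack is a non-empty subset that is a rack under the restricted operation. A decomposition of a rack $X$ is a pair of subracks $R,S$ of $X$ with $R\cup S=X$, $R\cap S=\emptyset$, and $x\rhd y\in S$, $y\rhd x\in R$ for all $x\in R$, $y\in S$. A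 rack $Y$ is of type D if it contains a subrack $X$ with a decomposition $X=R\cup S$ and elements $r\in R$, $s\in S$ such that $r\rhd(s\rhd(r\rhd s))\neq s$. *)

(* Defs.v *)
From HB Require Import structures.
From mathcomp Require Import all_boot all_algebra all_fingroup.
Set Implicit Arguments.
Unset Strict Implicit.
Unset Printing Implicit Defensive.

Import GRing.Theory.
Local Open Scope group_scope.

(* Racks are carried by subsets of an ambient finite type: conjugacy classes
   and their subracks are then sets sharing one operation, and "subrack" asks
   the restricted operation to satisfy the rack axioms afresh. *)
Section Racks.
Variables (T : finType) (op : T -> T -> T).

Record is_rack (X : {set T}) : Prop := IsRack {
  rack_neq0 : X != set0;
  rack_closed : {in X &, forall x y, op x y \in X};
  rack_idem : {in X, forall x, op x x = x};
  rack_distr : {in X & &, forall x y z,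
                 op x (op y z) = op (op x y) (op x z)};
  rack_inj : {in X, forall x, {in X &, injective (op x)}};
  rack_surj : {in X, forall x, op x @: X = X} }.

Definition subrack (Y X : {set T}) : Prop := X \subset Y /\ is_rack X.

Record decomposition (X R S : {set T}) : Prop := Decomposition {
  decomp_subrackl : subrack X R;
  decomp_subrackr : subrack X S;
  decomp_cover : R :|: S = X;
  decomp_disjoint : R :&: S = set0;
  decomp_stabler : {in R & S, forall x y, op x y \in S};
  decomp_stablel : {in R & S, forall x y, op y x \in R} }.

Definition type_D (Y : {set T}) : Prop :=
  exists X R S : {set T},
    [/\ subrack Y X, decomposition X R S &
        exists r s, [/\ r \in R, s \in S & op r (op s (op r s)) <> s]].

End Racks.

(* [_ ^ _] is [y^-1 * x * y] in fingroup, hence this separate definition. *)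
Definition conj_op (gT : finGroupType) (x y : gT) : gT := x * y * x^-1.

Definition vec2 (n : nat) := {ffun 'I_n -> 'Z_2}.

Definition perm_vec n (s : 'S_n) (a : vec2 n) : vec2 n :=
  [ffun i => a (s^-1 i)].

(* An alias of the product type, so that the semidirect product law does not
   clash with the direct product law that fingroup puts on pairs. *)
Definition wreath (n : nat) : Type := (vec2 n * 'S_n)%type.

Section Wreath.
Variable n : nat.

HB.instance Definition _ := Finite.copy (wreath n) (vec2 n * 'S_n)%type.

(* In [{perm _}], [t * s] is the map [i |-> s (t i)]: the composite of
   permutations written "s t" for functions acting on the left. *)
Definition wreath_mul (x y : wreath n) : wreath n :=
  ((x.1 + perm_vec x.2 y.1)%R, y.2 * x.2).

Definition wreath_one : wreath n := (0%R, 1).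

Definition wreath_inv (x : wreath n) : wreath n :=
  ((- perm_vec x.2^-1 x.1)%R, x.2^-1).

Lemma wreath_mulA : associative wreath_mul.
Proof.
move=> [a s] [b t] [c u]; rewrite /wreath_mul /=; congr (_, _); last first.
  by rewrite mulgA.
by apply/ffunP=> i; rewrite !ffunE invMg permM addrA.
Qed.

Lemma wreath_mul1 : left_id wreath_one wreath_mul.
Proof.
move=> [a s]; rewrite /wreath_mul /= mulg1; congr (_, _).
by apply/ffunP=> i; rewrite !ffunE invg1 perm1 add0r.
Qed.

Lemma wreath_mulV : left_inverse wreath_one wreath_inv wreath_mul.
Proof.
move=> [a s]; rewrite /wreath_mul /= mulgV; congr (_, _).
by apply/ffunP=> i; rewrite !ffunE addNr.
Qed.

HB.instance Definition _ :=
  Finite_isGroup.Build (wreath n) wreath_mulA wreath_mul1 wreath_mulV.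

(* K_n ><| S_n, where K_n is the hyperplane a_1 + ... + a_n = 0. *)
Definition even_wreath : {set wreath n} :=
  [set x : wreath n | (\sum_i x.1 i == 0)%R].

Lemma even_wreath_group_set : group_set even_wreath.
Proof.
apply/group_setP; split=> [|x y].
  by rewrite inE big1 // => i _; rewrite ffunE.
rewrite !inE => /eqP x0 /eqP y0.
rewrite -[X in X == _]/(\sum_i (x.1 + perm_vec x.2 y.1)%R i)%R.
under eq_bigr => i _ do rewrite !ffunE.
rewrite big_split /= x0 add0r (reindex_inj (@perm_inj _ x.2)) /=.
by under eq_bigr => i _ do rewrite permK; rewrite y0.
Qed.

Canonical even_wreath_group := Group even_wreath_group_set.

End Wreath.

Definition ncycles n (t : 'S_n) (k : nat) : nat :=
  #|[set C in porbits t | #|C| == k]|.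

(* [ts] lists the pairs (k, lambda_k) with lambda_k > 0; a length that is not
   listed has no cycle, so that n is determined by [ts]. *)
Definition has_type n (t : 'S_n) (ts : seq (nat * nat)) : Prop :=
  forall k, ncycles t k = \sum_(p <- ts | p.1 == k) p.2.

(* Main.v *)
Require Import Defs.
From mathcomp Require Import all_boot all_algebra all_fingroup.
From mathcomp Require Import ring zify.

Set Implicit Arguments.
Unset Strict Implicit.
Unset Printing Implicit Defensive.

Import GRing.Theory.
Local Open Scope group_scope.

(** A conjugacy class is of type D as soon as it contains two elements [r] and
    [s] that are not conjugate in the subgroup [H] they generate and satisfy
    [(rs)^2 <> (sr)^2]: then [r^H] and [s^H] are the two halves of the
    decomposition ([type_D_class]).  So if the class of [r = (a, t)] is not of
    type D, no conjugate [s] of [r] has these two properties, and the theorem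
    follows by exhibiting such an [s] for every [(a, t)] outside the list.

    Conjugating by elements of [K_n ><| S_n] only, all these [s] serve both
    groups at once.  A conjugator can be supported on a few cycles of [t], and
    it then changes [r] on those cycles only; so the two requirements can be
    met on two disjoint sets of cycles ([locally_combine]).

    Non-conjugacy in [H].  On some cycles, let [s] be a permutation that
    commutes with that of [r] and differs from it: then every conjugate of [r]
    under [H] still acts there as [r] does, and [s] does not.  This happens
    for one cycle of length at least 3 (invert it), two transpositions (pass
    to another element of the Klein four-group), a transposition and two fixed
    points (pass to the disjoint transposition).  It also happens for two
    fixed points carrying different signs (exchange the signs).

    The inequality [(rs)^2 <> (sr)^2].  In the symmetric group it is obtained
    on a transposition and a fixed point, on a 4-cycle, and on three
    transpositions.  On a 3-cycle it is obtained in the sign vectors, where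
    the square difference is a power of [1 + t] applied to a vector of sum 0,
    and [1 + t] is injective on such vectors when the cycle is odd.

    Combining both lists settles every type except those in the theorem and
    some where one set of cycles must serve for both purposes: (1,4), (2,4),
    and the types with a cycle of length at least 5.  The types (1,4), (2,4)
    and (6) have explicit solutions with coordinates in Z/5 and Z/3.  A cycle
    of any other length [m >= 5] has a multiplier [k] prime to [m] with
    [1 < k < m - 2]; one takes [s] acting as [t^k], which commutes with [t] and
    differs from it, and then the sign vector of [s] can be adjusted to get the
    inequality ([locally_power]).

    Writing [c_k] for the number of [k]-cycles, all this becomes a list of
    inequalities, from which the possible types are read off using
    [c_1 + 2 c_2 + 3 c_3 + 4 c_4 = n]. *)

(** * A criterion for a conjugacy class to be of type D *)

Section TypeDCriterion.
Variable gT : finGroupType.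
Implicit Types (r s : gT) (X : {set gT}) (G : {group gT}).

Lemma conj_opE (x y : gT) : conj_op x y = y ^ x^-1.
Proof. by rewrite /conj_op conjgE invgK mulgA. Qed.

(** Being stated for sets rather than for classes, this applies to the two
    halves of a decomposition and to their union alike. *)
Lemma is_rack_conj X : X != set0 -> X \subset 'N(X) -> is_rack (@conj_op gT) X.
Proof.
move=> X0 /subsetP nXX.
have opX x y : x \in X -> (conj_op x y \in X) = (y \in X).
  by move=> Xx; rewrite conj_opE memJ_norm // groupV nXX.
split=> // [x y Xx | x _ | x y z _ _ _ | x Xx y z _ _ | x Xx].
- by rewrite opX.
- by rewrite /conj_op mulgK.
- by rewrite !conj_opE -!conjgM -conjVg -conjgC.
- by rewrite !conj_opE => /conjg_inj.
apply/setP=> y; apply/imsetP/idP=> [[z Xz ->] | Xy]; first by rewrite opX.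
by exists (y ^ x); rewrite ?conj_opE ?conjgK ?memJ_norm ?nXX.
Qed.

(** Whatever is normalised by [r] and [s] is stable under conjugation by the
    group they generate, so this says that [s] is not a conjugate of [r] there,
    without mentioning that group. *)
Definition separated r s :=
  exists P : {set gT}, [/\ r \in P, s \notin P, r \in 'N(P) & s \in 'N(P)].

(** The inequality [r |> (s |> (r |> s)) <> s], cleared of inverses. *)
Definition unbraided r s := r * s * (r * s) <> s * r * (s * r).

Definition type_D_pair r s := separated r s /\ unbraided r s.

Lemma type_D_class G (x r s : gT) :
    x \in G -> r \in x ^: G -> s \in x ^: G ->
  type_D_pair r s -> type_D (@conj_op gT) (x ^: G).
Proof.
move=> Gx xGr xGs [[P [Pr P's nPr nPs]] Nrs].
have sub_class y : y \in x ^: G -> y \in G.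
  by move=> /(subsetP (class_subG Gx (subxx G))).
pose H := <<[set r; s]>>%G.
have [Hr Hs] : r \in H /\ s \in H by rewrite !mem_gen ?inE ?eqxx ?orbT.
have sHG : H \subset G.
  by rewrite gen_subG; apply/subsetP=> y /set2P[] ->; apply: sub_class.
have class_in_H y : y \in H -> y ^: H \subset H.
  by move=> Hy; apply: class_subG.
have class_in_G y : y \in x ^: G -> y ^: H \subset x ^: G.
  by move=> /class_eqP <-; apply: classS.
have rackH X : X \subset H -> X != set0 -> H \subset 'N(X) ->
    is_rack (@conj_op gT) X.
  by move=> sXH X0 nXH; apply: is_rack_conj => //; apply: subset_trans nXH.
have class_n0 y : y ^: H != set0 by apply/set0Pn; exists y; apply: class_refl.
have stab z y u : z \in H -> y \in u ^: H -> conj_op z y \in u ^: H.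
  by move=> Hz uy; rewrite conj_opE memJ_norm // groupV (subsetP (class_norm u H)).
exists (r ^: H :|: s ^: H), (r ^: H), (s ^: H); split.
- split; first by rewrite subUset !class_in_G.
  apply: rackH; first by rewrite subUset !class_in_H.
    by case/set0Pn: (class_n0 r) => y ry; apply/set0Pn; exists y; rewrite inE ry.
  by apply: normsU; apply: class_norm.
- split=> //.
  + by split; [apply: subsetUl | apply: rackH; rewrite ?class_in_H ?class_norm].
  + by split; [apply: subsetUr | apply: rackH; rewrite ?class_in_H ?class_norm].
  + apply/setP=> y; rewrite in_set0 inE; apply/negP=> /andP[ry].
    rewrite class_sym => /class_trans/(_ ry) rs; case/negP: P's.
    apply: (subsetP _ _ rs); rewrite class_sub_norm //.
    by rewrite gen_subG; apply/subsetP=> z /set2P[] ->.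
  + by move=> y z ry sz; apply: stab => //; apply: subsetP ry; apply: class_in_H.
  + by move=> y z ry sz; apply: stab => //; apply: subsetP sz; apply: class_in_H.
exists r, s; split; rewrite ?class_refl // => eq_s; apply: Nrs.
have := congr1 (mulg^~ (r * s * r)) eq_s.
by rewrite /conj_op !mulgA !mulgKV.
Qed.

End TypeDCriterion.

(** * The action on signed points *)

Section SignedPoints.
Variable n : nat.
Implicit Types (x y h r s : wreath n) (p : 'I_n * 'Z_2).

(** The standard faithful action of the wreath product on [2n] points.  It
    makes signs and permutation parts behave alike: a conjugate is known as
    soon as its action is known, and products need no formula for vectors. *)
Definition wact x p := (x.2 p.1, (p.2 + x.1 (x.2 p.1))%R).

Lemma wactM x y p : wact (x * y) p = wact x (wact y p).
Proof.
case: p => i e; rewrite /wact /= permM; congr (_, _).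
by rewrite /= !ffunE permK -addrA [(y.1 _ + _)%R]addrC.
Qed.

Lemma wact1 p : wact 1 p = p.
Proof. by case: p => i e; rewrite /wact /= perm1 ffunE addr0. Qed.

Lemma wact_inj x : injective (wact x).
Proof.
by move=> p q /(congr1 (wact x^-1)); rewrite -!wactM mulVg !wact1.
Qed.

Lemma perm_wreathM x y i : (x * y).2 i = x.2 (y.2 i).
Proof. exact: permM. Qed.

Lemma perm_wreathV x : x^-1.2 = x.2^-1.
Proof. by []. Qed.

End SignedPoints.

(** * Conjugation supported on a few cycles *)

Section Localisation.
Variable n : nat.
Implicit Types (r s h : wreath n) (A B : {set 'I_n}) (t : 'S_n).

Definition supported A h := forall p, p.1 \notin A -> wact h p = p.

(** For [A := setT] this says [s = r ^ h^-1].  In general it says what an [s]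
    obtained by a larger conjugation looks like over the part where the
    conjugator coincides with [h]. *)
Definition intertwines A h r s :=
  forall p, p.1 \in A -> wact s (wact h p) = wact h (wact r p).

(** [Q r s] can be forced by conjugating [r] over [A] alone, no matter what is
    done to [r] elsewhere.  The conjugator is taken in [K_n ><| S_n], the
    smaller of the two groups. *)
Definition locally (Q : wreath n -> wreath n -> Prop) r A :=
  exists h, [/\ h \in even_wreath n, supported A h &
                forall s, intertwines A h r s -> Q r s].

Lemma supported_stable A h p : supported A h -> p.1 \in A -> (wact h p).1 \in A.
Proof.
move=> sAh Ap; apply/negPn/negP=> hpNA.
by move: (hpNA); rewrite (wact_inj (sAh _ hpNA)) Ap.
Qed.

(** Conjugators with disjoint supports do not interfere: their product acts
    over [A] as the first and over [B] as the second, so that the resulting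
    conjugate meets both requirements. *)
Lemma locally_combine (Q1 Q2 : wreath n -> wreath n -> Prop) r A B :
    {in A, forall i, r.2 i \in A} -> {in B, forall i, r.2 i \in B} ->
    [disjoint A & B] -> locally Q1 r A -> locally Q2 r B ->
  exists2 s, s \in r ^: even_wreath n & Q1 r s /\ Q2 r s.
Proof.
move=> rA rB disAB [h [Eh Ah Qh]] [k [Ek Bk Qk]].
have hk p : p.1 \in A -> wact (h * k) p = wact h p.
  by move=> Ap; rewrite wactM Bk // (disjointFr disAB Ap).
have kh p : p.1 \in B -> wact (h * k) p = wact k p.
  move=> Bp; rewrite wactM Ah // (disjointFl disAB) //.
  exact: supported_stable Bk Bp.
have conj_act p :
    wact (r ^ (h * k)^-1) (wact (h * k) p) = wact (h * k) (wact r p).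
  by rewrite -!wactM -conjgCV.
exists (r ^ (h * k)^-1).
  apply: imset_f; rewrite (groupV (even_wreath_group n)).
  by rewrite (groupM (G := even_wreath_group n)).
split; [apply: Qh | apply: Qk] => p pA.
  by rewrite -hk // conj_act hk // /wact /= rA.
by rewrite -kh // conj_act kh // /wact /= rB.
Qed.

Lemma locally_class (Q : wreath n -> wreath n -> Prop) r A :
  locally Q r A -> exists2 s, s \in r ^: even_wreath n & Q r s.
Proof.
case=> h [Eh _ Qh]; exists (r ^ h^-1).
  by apply: imset_f; rewrite (groupV (even_wreath_group n)).
by apply: Qh => p _; rewrite -!wactM -conjgCV.
Qed.

(** Encoded through the list of cycles, so that disjointness of two regions is
    uniqueness of a list. *)
Definition region t xs := [set i | porbit t i \in map (porbit t) xs].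

Lemma region_stable t xs : {in region t xs, forall i, t i \in region t xs}.
Proof. by move=> i; rewrite !inE -(porbit_perm t 1 i) expg1. Qed.

Lemma region_disjoint t xs ys :
  uniq (map (porbit t) (xs ++ ys)) -> [disjoint region t xs & region t ys].
Proof.
rewrite map_cat cat_uniq => /and3P[_ /hasPn xys _].
apply/pred0P=> i /=; rewrite !inE; apply/negP=> /andP[ix /xys].
by rewrite ix.
Qed.

End Localisation.

(** * Permutations described by labels *)

Section Labels.
Variables (n : nat) (L : finType) (lab : L -> 'I_n).
Hypothesis lab_inj : injective lab.
Implicit Types (r s h : wreath n) (A : {set 'I_n}).

(** The points of a few cycles are named by an injection [lab] from a finite
    type, chosen so that [r] and its conjugate have simple formulas [rho] and
    [sigma] on labels.  A permutation of the labels is realised by a conjugator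
    with zero vector, which therefore lies in [K_n ><| S_n]. *)
Lemma relabelling A (q : L -> L) : (forall l, lab l \in A) -> injective q ->
  exists h, [/\ h \in even_wreath n, supported A h &
    forall l e, wact h (lab l, e) = (lab (q l), e)].
Proof.
move=> Alab q_inj.
pose f i := if [pick l | lab l == i] is Some l then lab (q l) else i.
have flab l : f (lab l) = lab (q l).
  rewrite /f; case: pickP => [l' /eqP/lab_inj -> //| /(_ l)].
  by rewrite eqxx.
have f_out i : (forall l, lab l != i) -> f i = i.
  by move=> iP; rewrite /f; case: pickP => // l; rewrite (negPf (iP l)).
have f_cases i : (exists l, i = lab l) \/ (forall l, lab l != i).
  case: (pickP (fun l => lab l == i)) => [l /eqP <- | iP]; first by left; exists l.
  by right=> l; rewrite iP.
have f_inj : injective f.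
  move=> i j; case: (f_cases i) (f_cases j) => [[l ->] | iP] [[m ->] | jP].
  - by rewrite !flab => /lab_inj/q_inj ->.
  - by rewrite flab f_out // => eq_j; case/eqP: (jP (q l)).
  - by rewrite flab f_out // => eq_i; case/eqP: (iP (q m)).
  - by rewrite !f_out.
exists ((0%R, perm f_inj) : wreath n); split.
- by rewrite inE big1 // => i _; rewrite ffunE.
- move=> [i e] iNA; rewrite /wact /= permE ffunE addr0 f_out // => l.
  by apply: contraNneq iNA => <-; apply: Alab.
- by move=> l e; rewrite /wact /= permE flab ffunE addr0.
Qed.

(** The conjugator is the relabelling [q], and it forces the action of [s] on
    the labelled points. *)
Lemma locally_labels (Q : wreath n -> wreath n -> Prop) r A (rho sigma q : L -> L) :
    (forall l, lab l \in A) -> (forall l, r.2 (lab l) = lab (rho l)) ->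
    injective q -> (forall l, sigma (q l) = q (rho l)) ->
    (forall s, (forall l, s.2 (lab l) = lab (sigma l)) -> Q r s) ->
  locally Q r A.
Proof.
move=> Alab r_lab q_inj q_conj QP.
have [h [Eh Ah hq]] := relabelling Alab q_inj.
exists h; split=> // s hrs; apply: QP => l.
have [q' qK q'K] := injF_bij q_inj; rewrite -[l]q'K q_conj.
have /(congr1 fst) := hrs (lab (q' l), 0%R) (Alab _).
by rewrite hq [wact r _]/wact r_lab hq.
Qed.

Lemma unbraided_labels r s (rho sigma : L -> L) l :
    (forall l, r.2 (lab l) = lab (rho l)) ->
    (forall l, s.2 (lab l) = lab (sigma l)) ->
    rho (sigma (rho (sigma l))) != sigma (rho (sigma (rho l))) ->
  unbraided r s.
Proof.
move=> r_lab s_lab /eqP neq_l eq_rs; apply/neq_l/lab_inj.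
have := congr1 (fun x : wreath n => x.2 (lab l)) eq_rs.
by rewrite !perm_wreathM !(r_lab, s_lab).
Qed.

(** The family [F] is meant to be the coset of [rho] modulo a subgroup
    normalised by [rho] and [sigma] and containing their commutator: an
    element acting by a member of the family keeps doing so when conjugated by
    [r] or [s], whereas [sigma] lies in another coset. *)
Lemma separated_labels r s (K : finType) (F : K -> L -> L) (rho sigma : L -> L) :
    (forall l, r.2 (lab l) = lab (rho l)) ->
    (forall l, s.2 (lab l) = lab (sigma l)) ->
    (exists k, F k =1 rho) -> (forall k, exists l, F k l != sigma l) ->
    (forall k, exists k', forall l, F k (rho l) = rho (F k' l)) ->
    (forall k, exists k', forall l, F k (sigma l) = sigma (F k' l)) ->
  separated r s.
Proof.
move=> r_lab s_lab [k0 Fk0] Fs Fr_conj Fs_conj.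
pose P := [set x : wreath n | [exists k, [forall l, x.2 (lab l) == lab (F k l)]]].
have PP (x : wreath n) :
    reflect (exists k, forall l, x.2 (lab l) = lab (F k l)) (x \in P).
  rewrite inE; apply: (iffP existsP) => -[k kP]; exists k.
    by move=> l; apply/eqP/(forallP kP).
  by apply/forallP=> l; apply/eqP/kP.
have norm_P (y : wreath n) (eta : L -> L) : (forall l, y.2 (lab l) = lab (eta l)) ->
    (forall k, exists k', forall l, F k (eta l) = eta (F k' l)) -> y \in 'N(P).
  move=> y_lab conj_eta; rewrite inE; apply/subsetP=> _ /imsetP[x /PP[k xk] ->].
  have [k' k'P] := conj_eta k; apply/PP; exists k' => l.
  rewrite conjgE 2!perm_wreathM y_lab xk k'P -y_lab.
  by rewrite perm_wreathV permK.
exists P; split.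
- by apply/PP; exists k0 => l; rewrite Fk0 r_lab.
- apply/PP=> -[k sk]; have [l /eqP[]] := Fs k; apply: lab_inj.
  by rewrite -sk s_lab.
- exact: norm_P r_lab Fr_conj.
- exact: norm_P s_lab Fs_conj.
Qed.

(** When [rho] and [sigma] commute, the coset reduces to [rho] itself. *)
Lemma separated_commute r s (rho sigma : L -> L) l :
    (forall l, r.2 (lab l) = lab (rho l)) ->
    (forall l, s.2 (lab l) = lab (sigma l)) ->
    (forall l, rho (sigma l) = sigma (rho l)) -> rho l != sigma l ->
  separated r s.
Proof.
move=> r_lab s_lab comm neq_l.
apply: (separated_labels (K := unit) (F := fun=> rho) r_lab s_lab).
- by exists tt.
- by exists l.
- by exists tt.
- by exists tt.
Qed.

End Labels.

(** * Labelling the points of given cycles *)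

Section CyclePoints.
Variables (n : nat) (t : 'S_n).
Implicit Types (x y : 'I_n) (xs ys : seq 'I_n) (ks : seq nat).

Definition cycle_reps xs ks :=
  map (fun x => #|porbit t x|) xs = ks /\ uniq (map (porbit t) xs).

Definition cycle_points xs := flatten [seq traject t x #|porbit t x| | x <- xs].

Lemma size_cycle_points xs :
  size (cycle_points xs) = sumn (map (fun x => #|porbit t x|) xs).
Proof.
rewrite size_flatten /shape -map_comp; congr sumn.
by apply: eq_map => x /=; rewrite size_traject.
Qed.

Lemma cycle_points_uniq xs : uniq (map (porbit t) xs) -> uniq (cycle_points xs).
Proof.
elim: xs => //= x xs IH /andP[x_xs Uxs].
rewrite cat_uniq uniq_traject_porbit IH // andbT /=; apply/hasPn=> y.
case/flatten_mapP=> z xs_z; rewrite -!porbit_traject -eq_porbit_mem => /eqP yz.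
apply: contra x_xs; rewrite -eq_porbit_mem => /eqP <-.
by rewrite yz map_f.
Qed.

Lemma cycle_points_region xs : {subset cycle_points xs <= region t xs}.
Proof.
move=> y /flatten_mapP[x xs_x]; rewrite -porbit_traject -eq_porbit_mem => /eqP yx.
by rewrite inE yx map_f.
Qed.

(** Listing cycles of lengths [ks] one after the other, each in cyclic order,
    this is the position to which the permutation moves position [i].  It
    depends on the lengths only, which turns statements about an unknown
    permutation into finite computations. *)
Fixpoint cycle_succ ks i :=
  if ks is k :: ks' then
    if i < k then (if i.+1 < k then i.+1 else 0) else k + cycle_succ ks' (i - k)
  else i.

Lemma cycle_points_succ x0 xs i0 : i0 < size (cycle_points xs) ->
  t (nth x0 (cycle_points xs) i0) =
  nth x0 (cycle_points xs) (cycle_succ (map (fun x => #|porbit t x|) xs) i0).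
Proof.
have nth_traj y i k : i < k -> nth x0 (traject t y k) i = iter i t y.
  by move=> lt_ik; rewrite (set_nth_default y) ?size_traject ?nth_traject.
elim: xs i0 => //= x xs IH i; rewrite /cycle_points /= size_cat size_traject => lti.
rewrite !nth_cat size_traject; case: ltnP => [lt_ik | le_ki].
  rewrite nth_traj //; have [lt_i1k | le_ki1] := ltnP i.+1 #|porbit t x|.
    by rewrite lt_i1k nth_traj.
  have def_k : i.+1 = #|porbit t x|.
    by apply/eqP; rewrite eqn_leq lt_ik.
  by rewrite (leq_ltn_trans _ lt_ik) // -iterS def_k iter_porbit nth_traj // -def_k.
rewrite ltnNge leq_addr /= addKn; apply: IH.
by rewrite -(ltn_add2l #|porbit t x|) subnKC.
Qed.

(** To label cycles of lengths [ks] so that [t] acts by [rho], it is enough to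
    give the position [e l] of each label in the list of their points. *)
Lemma reps_labels (L : finType) xs ks (e : L -> nat) (rho : L -> L) :
    cycle_reps xs ks -> injective e -> (forall l, e l < sumn ks) ->
    (forall l, cycle_succ ks (e l) = e (rho l)) ->
  exists lab : L -> 'I_n, [/\ injective lab, forall l, lab l \in region t xs
                            & forall l, t (lab l) = lab (rho l)].
Proof.
case=> <- Uxs e_inj e_lt e_succ; rewrite -size_cycle_points in e_lt.
exists (fun l => tnth (in_tuple (cycle_points xs)) (Ordinal (e_lt l))); split.
- move=> l l'; have x0 := tnth (in_tuple _) (Ordinal (e_lt l)).
  rewrite !(tnth_nth x0) => /eqP.
  by rewrite nth_uniq ?cycle_points_uniq // => /eqP/e_inj.
- by move=> l; apply/cycle_points_region/mem_tnth.
move=> l; have x0 := tnth (in_tuple _) (Ordinal (e_lt l)).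
by rewrite !(tnth_nth x0) cycle_points_succ ?e_succ.
Qed.

End CyclePoints.

(* These prove identities over the label types used below by going through all
   their elements. *)
Ltac by_eval := first [by [] | by apply/eqP | by move=> _; apply/eqP].
Ltac z3_cases := let i := fresh in case=> [[|[|[|//]]] i].
Ltac z4_cases := let i := fresh in case=> [[|[|[|[|//]]]] i].
Ltac z5_cases := let i := fresh in case=> [[|[|[|[|[|//]]]]] i].
Ltac z3b_cases := let i := fresh in case=> [[[|[|[|//]]] i] []].

(** * Configurations of cycles of length at most 6 *)

Section SmallModels.
Variables (n : nat) (r : wreath n).
Implicit Types (s : wreath n) (xs : seq 'I_n).
Local Notation t := r.2.

(** Two transpositions: [(x x')(y y')] becomes [(x y)(x' y')], another element
    of the same Klein four-group. *)
Lemma separated22 xs : cycle_reps t xs [:: 2; 2]%N ->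
  locally (@separated _) r (region t xs).
Proof.
pose e (l : bool * bool) := (l.1.*2 + l.2)%N.
pose rho (l : bool * bool) := (l.1, ~~ l.2).
move=> /(reps_labels (e := e) (rho := rho))[].
- by case=> [[] []] [[] []].
- by case=> [[] []].
- by case=> [[] []].
move=> lab [lab_inj labR t_lab].
apply: (locally_labels lab_inj (sigma := fun l => (~~ l.1, l.2))
  (q := fun l => (l.2, l.1)) labR t_lab) => //.
- by move=> [a b] [a' b'] [-> ->].
by move=> s s_lab; apply: (separated_commute lab_inj (l := (true, true)) t_lab s_lab).
Qed.

(** A transposition and two fixed points: [(x x')] becomes the disjoint
    transposition [(y z)]. *)
Lemma separated211 xs : cycle_reps t xs [:: 2; 1; 1]%N ->
  locally (@separated _) r (region t xs).
Proof.
pose e (l : bool * bool) := (l.1.*2 + l.2)%N.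
pose rho (l : bool * bool) := (l.1, l.1 (+) ~~ l.2).
move=> /(reps_labels (e := e) (rho := rho))[].
- by case=> [[] []] [[] []].
- by case=> [[] []].
- by case=> [[] []].
move=> lab [lab_inj labR t_lab].
apply: (locally_labels lab_inj (sigma := fun l => (l.1, l.1 (+) l.2))
  (q := fun l => (~~ l.1, l.2)) labR t_lab) => //.
- by move=> [[] []] [[] []].
- by move=> [[] []].
move=> s s_lab.
apply: (separated_commute lab_inj (l := (true, true)) t_lab s_lab) => //.
by case=> [[] []].
Qed.

(** Here [r] and [s] act as two reflections of a triangle, whose product has
    order 3. *)
Lemma unbraided21 xs : cycle_reps t xs [:: 2; 1]%N ->
  locally (@unbraided _) r (region t xs).
Proof.
pose e (l : 'Z_3) := nth 0 [:: 2; 0; 1]%N l.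
move=> /(reps_labels (e := e) (rho := fun l => (- l)%R))[].
- by do 2!z3_cases; by_eval.
- by z3_cases; by_eval.
- by z3_cases; by_eval.
move=> lab [lab_inj labR t_lab].
apply: (locally_labels lab_inj (sigma := fun l => (-1 - l)%R)
  (q := fun l => (l + 1)%R) labR t_lab).
- exact: addIr.
- by z3_cases; by_eval.
move=> s s_lab; exact: (unbraided_labels lab_inj (l := 0%R) t_lab s_lab).
Qed.

(** Exchanging two consecutive points of a 4-cycle gives a 4-cycle such that
    [r s] and [s r] are 3-cycles with different fixed points on the cycle. *)
Lemma unbraided4 xs : cycle_reps t xs [:: 4]%N ->
  locally (@unbraided _) r (region t xs).
Proof.
pose e (l : 'Z_4) := val l.
move=> /(reps_labels (e := e) (rho := fun l => (l + 1)%R))[].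
- exact: val_inj.
- by move=> l; apply: leq_trans (ltn_ord l) _.
- by z4_cases; by_eval.
move=> lab [lab_inj labR t_lab].
apply: (locally_labels lab_inj (sigma := fun l => nth 0%R [:: 2; 0; 3; 1]%R l)
  (q := fun l => nth 0%R [:: 1; 0; 2; 3]%R l) labR t_lab).
- by do 2!z4_cases; by_eval.
- by z4_cases; by_eval.
move=> s s_lab; exact: (unbraided_labels lab_inj (l := 0%R) t_lab s_lab).
Qed.

(** Three transpositions: [r] and [s] are the two perfect matchings of a
    hexagon, and [r s] rotates its two triangles in opposite directions. *)
Lemma unbraided222 xs : cycle_reps t xs [:: 2; 2; 2]%N ->
  locally (@unbraided _) r (region t xs).
Proof.
pose e (l : 'Z_3 * bool) := ((val l.1).*2 + l.2)%N.
pose rho (l : 'Z_3 * bool) := (l.1, ~~ l.2).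
move=> /(reps_labels (e := e) (rho := rho))[].
- by do 2!z3b_cases; by_eval.
- by z3b_cases; by_eval.
- by z3b_cases; by_eval.
move=> lab [lab_inj labR t_lab].
apply: (locally_labels lab_inj
  (sigma := fun l => (if l.2 then (l.1 - 1)%R else (l.1 + 1)%R, ~~ l.2))
  (q := fun l => (if l.2 then (l.1 + 1)%R else l.1, l.2)) labR t_lab).
- by do 2!z3b_cases; by_eval.
- by z3b_cases; by_eval.
move=> s s_lab; exact: (unbraided_labels lab_inj (l := (0%R, true)) t_lab s_lab).
Qed.

(** The 4-cycle is [l |-> 2 l] on Z/5, with fixed point 0, and [s] is
    [l |-> 3 l + 1].  In the affine group of Z/5 the multiplier is invariant
    under conjugation and separates them, while [r s] and [s r] are two
    different translations. *)
Lemma type_D_pair41 xs : cycle_reps t xs [:: 4; 1]%N ->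
  locally (@type_D_pair _) r (region t xs).
Proof.
pose e (l : 'Z_5) := nth 0 [:: 4; 0; 1; 3; 2]%N l.
move=> /(reps_labels (e := e) (rho := fun l => (2%:R * l)%R))[].
- by do 2!z5_cases; by_eval.
- by z5_cases; by_eval.
- by z5_cases; by_eval.
move=> lab [lab_inj labR t_lab].
apply: (locally_labels lab_inj (sigma := fun l => (3%:R * l + 1)%R)
  (q := fun l => nth 0%R [:: 2; 0; 1; 3; 4]%R l) labR t_lab).
- by do 2!z5_cases; by_eval.
- by z5_cases; by_eval.
move=> s s_lab; split.
  apply: (separated_labels lab_inj (F := fun k l => (2%:R * l + k)%R) t_lab s_lab).
  - by exists 0%R; z5_cases; by_eval.
  - move=> k; have [k1 | k_n1] := eqVneq k 1%R; first by exists 1%R; rewrite k1.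
    by exists 0%R; move: k k_n1; z5_cases; by_eval.
  - by move=> k; exists (3%:R * k)%R; move: k; do 2!z5_cases; by_eval.
  - by move=> k; exists (2%:R * (k + 1))%R; move: k; do 2!z5_cases; by_eval.
exact: (unbraided_labels lab_inj (l := 0%R) t_lab s_lab).
Qed.

(** On two copies of Z/3, exchanged by both elements, [r] reverses orientation
    on the way up and [s] on the way down.  This is the invariant that
    separates them, while [r s] and [s r] rotate one copy each, not the same
    one. *)
Lemma type_D_pair24 xs : cycle_reps t xs [:: 2; 4]%N ->
  locally (@type_D_pair _) r (region t xs).
Proof.
pose e (l : 'Z_3 * bool) := nth 0 (if l.2 then [:: 1; 5; 3] else [:: 0; 2; 4])%N l.1.
pose rho (l : 'Z_3 * bool) := (if l.2 then l.1 else (- l.1)%R, ~~ l.2).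
move=> /(reps_labels (e := e) (rho := rho))[].
- by do 2!z3b_cases; by_eval.
- by z3b_cases; by_eval.
- by z3b_cases; by_eval.
move=> lab [lab_inj labR t_lab].
apply: (locally_labels lab_inj
  (sigma := fun l => (if l.2 then (1 - l.1)%R else l.1, ~~ l.2))
  (q := fun l => ((2%:R - l.1)%R, ~~ l.2)) labR t_lab).
- by do 2!z3b_cases; by_eval.
- by z3b_cases; by_eval.
move=> s s_lab; split.
  apply: (separated_labels lab_inj (K := ('Z_3 * 'Z_3)%type) (F := fun k l =>
    (if l.2 then (l.1 + k.2)%R else (k.1 - l.1)%R, ~~ l.2)) t_lab s_lab).
  - by exists (0%R, 0%R); z3b_cases; by_eval.
  - move=> [k k']; have [k0 | k_n0] := eqVneq k 0%R.
      by exists (1%R, false); rewrite k0.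
    by exists (0%R, false); move: k k_n0; z3_cases; by_eval.
  - move=> [k k']; exists (k', - k)%R.
    by move: k k'; do 2!z3_cases; z3b_cases; by_eval.
  - move=> [k k']; exists (1 - k', k - 1)%R.
    by move: k k'; do 2!z3_cases; z3b_cases; by_eval.
exact: (unbraided_labels lab_inj (l := (0%R, true)) t_lab s_lab).
Qed.

(** On two copies of Z/3, exchanged by both elements, the total shift over a
    round trip is invariant under conjugation; it is 2 for [r] and 1 for [s].
    The 6-cycle is written in these coordinates by the Chinese remainder
    theorem. *)
Lemma type_D_pair6 xs : cycle_reps t xs [:: 6]%N ->
  locally (@type_D_pair _) r (region t xs).
Proof.
pose e (l : 'Z_3 * bool) := nth 0 (if l.2 then [:: 3; 1; 5] else [:: 0; 4; 2])%N l.1.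
pose rho (l : 'Z_3 * bool) := ((l.1 + 1)%R, ~~ l.2).
move=> /(reps_labels (e := e) (rho := rho))[].
- by do 2!z3b_cases; by_eval.
- by z3b_cases; by_eval.
- by z3b_cases; by_eval.
move=> lab [lab_inj labR t_lab].
apply: (locally_labels lab_inj
  (sigma := fun l => (if l.2 then (l.1 + 1)%R else l.1, ~~ l.2))
  (q := fun l => (if l.2 then (1 - l.1)%R else (- l.1)%R, l.2)) labR t_lab).
- by do 2!z3b_cases; by_eval.
- by z3b_cases; by_eval.
move=> s s_lab; split.
  apply: (separated_labels lab_inj (F := fun p l =>
    (if l.2 then (l.1 + 2%:R - p)%R else (l.1 + p)%R, ~~ l.2)) t_lab s_lab).
  - by exists 1%R; z3b_cases; by_eval.
  - move=> p; have [p0 | p_n0] := eqVneq p 0%R.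
      by exists (0%R, true); rewrite p0.
    by exists (0%R, false); move: p p_n0; z3_cases; by_eval.
  - by move=> p; exists (2%:R - p)%R; move: p; z3_cases; z3b_cases; by_eval.
  - by move=> p; exists (1 - p)%R; move: p; z3_cases; z3b_cases; by_eval.
exact: (unbraided_labels lab_inj (l := (0%R, true)) t_lab s_lab).
Qed.

End SmallModels.

(** * Signs, and cycles of arbitrary length *)

Section Signs.
Variables (n : nat) (r : wreath n).
Implicit Types (s : wreath n) (xs : seq 'I_n).
Local Notation t := r.2.

Lemma cycle_labels xs m : 1 < m -> cycle_reps t xs [:: m] ->
  exists lab : 'Z_m -> 'I_n, [/\ injective lab,
    forall l, lab l \in region t xs & forall l, t (lab l) = lab (l + 1)%R].
Proof.
pose rho (l : 'Z_m) : 'Z_m := (l + 1)%R.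
move=> m_gt1 /(reps_labels (e := fun l : 'Z_m => val l) (rho := rho))[] //.
- exact: val_inj.
- by move=> l; rewrite /= addn0 -[X in _ < X](Zp_cast m_gt1).
move=> l; have lt_lm : l < m by rewrite -[X in _ < X](Zp_cast m_gt1).
have -> : val (l + 1)%R = (l.+1 %% m)%N.
  by have := val_Zp_nat m_gt1 (l + 1); rewrite natrD natr_Zp addn1.
rewrite /= lt_lm.
have [lt_l1m | le_ml1] := ltnP; first by rewrite modn_small.
have -> : l.+1 = m by apply/eqP; rewrite eqn_leq lt_lm.
by rewrite modnn.
by move=> lab labP; exists lab.
Qed.

(** The conjugate is the inverse cycle, which differs from the cycle from
    length 3 on. *)
Lemma separated_cycle xs m : 2 < m -> cycle_reps t xs [:: m] ->
  locally (@separated _) r (region t xs).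
Proof.
move=> m_gt2 xsm; have m_gt1 := ltnW m_gt2.
have [lab [lab_inj labR t_lab]] := cycle_labels m_gt1 xsm.
apply: (locally_labels lab_inj (sigma := fun l => (l - 1)%R)
  (q := fun l => (- l)%R) labR t_lab).
- exact: oppr_inj.
- by move=> l; rewrite opprD.
move=> s s_lab.
apply: (separated_commute lab_inj (l := 0%R) t_lab s_lab) => [l|].
  by rewrite addrK subrK.
have /eqP : (2%:R : 'Z_m)%R <> 0%R.
  by move=> /(congr1 (@nat_of_ord _)); rewrite val_Zp_nat // modn_small.
by rewrite add0r sub0r -addr_eq0.
Qed.

(** The analogue of [separated_commute] on signed points, used where the
    elements differ by their vectors only. *)
Lemma separated_signed s (O : pred ('I_n * 'Z_2)) p :
    (forall q, O q -> O (wact r q)) -> (forall q, O q -> O (wact s q)) ->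
    (forall q, O q -> wact r (wact s q) = wact s (wact r q)) ->
    O p -> wact r p != wact s p ->
  separated r s.
Proof.
move=> rO sO comm Op neq_p.
pose P := [set x : wreath n | [forall (q | O q), wact x q == wact r q]].
have PP (x : wreath n) : reflect (forall q, O q -> wact x q = wact r q) (x \in P).
  by rewrite inE; apply: (iffP forall_inP) => xP q /xP /eqP.
have norm_P (y : wreath n) : (forall q, O q -> O (wact y q)) ->
    (forall q, O q -> wact r (wact y q) = wact y (wact r q)) -> y \in 'N(P).
  move=> yO comm_y; rewrite inE; apply/subsetP=> _ /imsetP[x /PP xr ->].
  apply/PP=> q Oq; apply: (@wact_inj _ y).
  by rewrite -wactM -conjgC wactM xr ?yO ?comm_y.
exists P; split; [by apply/PP | | exact: norm_P | exact: norm_P].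
by apply/PP=> /(_ p Op) sp; rewrite sp eqxx in neq_p.
Qed.

(** Over two fixed points everything happens in an abelian group of signs, so
    that exchanging two different signs gives an element that is not
    conjugate to the first one. *)
Lemma separated_fixed x y : t x = x -> t y = y -> r.1 x != r.1 y ->
  locally (@separated _) r (region t [:: x; y]).
Proof.
move=> tx ty neq_xy.
pose lab b := if b then y else x.
have lab_inj : injective lab.
  by case=> [] [] //= eq_xy; rewrite eq_xy eqxx in neq_xy.
have labR b : lab b \in region t [:: x; y].
  by rewrite inE map_f //; case: b; rewrite !inE eqxx ?orbT.
have r_lab b e : wact r (lab b, e) = (lab b, (e + r.1 (lab b))%R).
  by rewrite /wact /=; case: b; rewrite /= ?tx ?ty.
have [h [Eh Ah h_lab]] := relabelling lab_inj labR (can_inj negbK).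
exists h; split=> // s hrs.
have s_lab b e : wact s (lab b, e) = (lab b, (e + r.1 (lab (~~ b)))%R).
  have := hrs (lab (~~ b), e) (labR _).
  by rewrite r_lab !h_lab negbK.
apply: (@separated_signed s (fun q => q.1 \in [:: x; y]) (x, 0%R)).
- by move=> [i e]; rewrite !inE => /orP[] /eqP /= ->; rewrite ?tx ?ty eqxx ?orbT.
- move=> [i e]; rewrite !inE => /orP[] /eqP /= ->.
    by have [-> _] := s_lab false e; rewrite eqxx.
  by have [-> _] := s_lab true e; rewrite eqxx orbT.
- have comm b e : wact r (wact s (lab b, e)) = wact s (wact r (lab b, e)).
    by rewrite s_lab !r_lab s_lab -!addrA [(r.1 (lab b) + _)%R]addrC.
  move=> [i e]; rewrite !inE => /orP[] /eqP /= ->; first exact: (comm false).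
  exact: (comm true).
- by rewrite !inE eqxx.
rewrite (r_lab false) (s_lab false) xpair_eqE eqxx /= !add0r.
exact: neq_xy.
Qed.

Lemma addrr2 (z : 'Z_2) : (z + z = 0)%R.
Proof. by move: z; case=> [[|[|//]] ?]; apply/eqP. Qed.

(** The vector of sum 0 marking the points [k] and [k + 1] of a cycle. *)
Definition pair_vec m (k l : 'Z_m) : 'Z_2 := ((l == k)%:R + (l == k + 1)%:R)%R.

(** Let [s] act on the cycle as [t ^ k].  Then [(rs)^2] and [(sr)^2] have the
    same permutation part, and adding [(1 + t^k) v] to the vector of [s], which
    is what conjugating by [v] does, adds [(1 + t)(1 + t^k)(1 + t^(k+1)) v] to
    the difference of their vectors.  The hypothesis says that for
    [v := pair_vec k] this correction has a coefficient 1 at the point where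
    the difference is read.  Hence [v] or 0 is a suitable correction, depending
    on the difference one starts with. *)
Lemma locally_power xs m (k : 'Z_m) :
    1 < m -> cycle_reps t xs [:: m] -> k \is a GRing.unit ->
    (pair_vec k 0 + pair_vec k 1 + pair_vec k k + pair_vec k (k + 2%:R) +
     pair_vec k (k + k + 1) + pair_vec k (k + k + 2%:R) = 1)%R ->
  exists lab : 'Z_m -> 'I_n, [/\ injective lab,
    forall l, t (lab l) = lab (l + 1)%R &
    locally (fun r s => (forall l, s.2 (lab l) = lab (l + k)%R) /\ unbraided r s)
      r (region t xs)].
Proof.
move=> m_gt1 xsm k_unit Vsum.
have [lab [lab_inj labR t_lab]] := cycle_labels m_gt1 xsm.
exists lab; split=> //.
have [h [Eh Ah h_lab]] := relabelling lab_inj labR (mulrI k_unit).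
pose V := pair_vec k; pose a l := r.1 (lab l); pose b l := a (k^-1 * l)%R.
(* [b] is the vector of the conjugate of [r] by [h] alone, [d] the resulting
   difference of signs at the point [lab 0], and [c] the multiple of the vector
   marking [k] and [k + 1] that makes this difference 1. *)
pose d : 'Z_2 := (b k + a (k + 1) + b (k + k + 1) + a (k + k + 2%:R) +
  a 1 + b (k + 1) + a (k + 2%:R) + b (k + k + 2%:R))%R.
pose c : 'Z_2 := (1 + d)%R.
pose v : vec2 n := [ffun i => c * ((i == lab k)%:R + (i == lab (k + 1))%:R)]%R.
have v_lab l : v (lab l) = (c * V l)%R by rewrite ffunE !(inj_eq lab_inj).
have w_act p : wact ((v, 1) : wreath n) p = (p.1, (p.2 + v p.1)%R).
  by rewrite /wact /= perm1.
have sum_pt i : (\sum_j (j == i)%:R = 1 :> 'Z_2)%R.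
  by rewrite (bigD1 i) //= eqxx big1 ?addr0 // => j /negPf ->.
exists (((v, 1) : wreath n) * h); split.
- rewrite (groupM (G := even_wreath_group n)) // inE.
  under eq_bigr do rewrite ffunE.
  by rewrite -big_distrr big_split /= !sum_pt addrr2 mulr0.
- move=> p pNA; rewrite wactM Ah // w_act ffunE.
  have ptF l : (p.1 == lab l) = false by apply: contraNF pNA => /eqP ->.
  by rewrite !ptF addr0 mulr0 addr0; case: p pNA ptF.
move=> s hrs.
have r_act l e : wact r (lab l, e) = (lab (l + 1), e + a (l + 1))%R.
  by rewrite /wact /= t_lab.
have s_act l e : wact s (lab l, e) =
    (lab (l + k), e + (b (l + k) + c * (V l + V (l + k))))%R.
  have [l' ->] : exists l', l = (k * l')%R by exists (k^-1 * l)%R; rewrite mulVKr.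
  have := hrs (lab l', (e + c * V (k * l'))%R) (labR _).
  rewrite r_act !wactM !h_lab !w_act /= !v_lab -[(e + _ + _)%R]addrA addrr2 addr0.
  move=> ->; rewrite mulrDr mulr1; congr (_, _).
  have -> : b (k * l' + k)%R = a (l' + 1)%R.
    by rewrite /b; congr a; rewrite -[X in (_ + X)%R]mulr1 -mulrDr mulKr.
  ring.
split=> [l | eq_rs]; first by have [] := s_act l 0%R.
have /(congr1 (fun f => (wact f (lab 0, 0)).2))%R := eq_rs.
rewrite !wactM !(s_act, r_act) /= => eq_sgn.
have [e1 e2] : (0 + 1 + k + 1 + k = k + k + 2%:R :> 'Z_m /\
  0 + k + 1 + k + 1 = k + k + 2%:R :> 'Z_m)%R by split; ring.
have [e3 e4] : (0 + k + 1 + k = k + k + 1 :> 'Z_m /\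
  0 + 1 + k + 1 = k + 2%:R :> 'Z_m)%R by split; ring.
have e5 : (0 + 1 + k = k + 1 :> 'Z_m)%R by ring.
rewrite e1 e2 e3 e4 e5 !add0r in eq_sgn.
have := addrr2 (a 1 + (b (k + 1) + c * (V 1 + V (k + 1))) + a (k + 2%:R) +
  (b (k + k + 2%:R) + c * (V (k + 2%:R) + V (k + k + 2%:R))))%R.
rewrite -{1}eq_sgn.
set lhs := (X in X = _); have -> : lhs = (d + c * (V 0 + V 1 + V k +
  V (k + 2%:R) + V (k + k + 1) + V (k + k + 2%:R)) +
  (c * V (k + 1) + c * V (k + 1)))%R by rewrite /lhs /d; ring.
by rewrite Vsum addrr2 addr0 mulr1 /c addrCA addrr2.
Qed.

End Signs.

Section Long.
Variables (n : nat) (r : wreath n).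
Implicit Types (s : wreath n) (xs : seq 'I_n).
Local Notation t := r.2.

(** The case [k = 1] of [locally_power]: only signs are modified. *)
Lemma unbraided3 xs : cycle_reps t xs [:: 3] ->
  locally (@unbraided _) r (region t xs).
Proof.
move=> xs3; have [] := @locally_power n r xs 3 1%R _ xs3 => //.
- by apply/eqP.
by move=> lab [_ _ [h [Eh Ah hP]]]; exists h; split=> // s /hP[].
Qed.

Lemma natr_Zp_neq0 m j : 1 < m -> 0 < j < m -> (j%:R : 'Z_m)%R != 0%R.
Proof.
move=> m_gt1 /andP[j_gt0 lt_jm]; apply/eqP=> /(congr1 (@nat_of_ord _)).
by rewrite val_Zp_nat // modn_small // => j0; rewrite j0 in j_gt0.
Qed.

(** Under the bounds on [k], exactly one of the six points at which
    [pair_vec k] is evaluated in [locally_power] is marked, namely [k]. *)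
Lemma type_D_pair_unit xs m k : cycle_reps t xs [:: m] ->
  1 < k -> k.+2 < m -> coprime m k -> locally (@type_D_pair _) r (region t xs).
Proof.
move=> xsm k_gt1 lt_km co_mk; have m_gt1 : 1 < m by lia.
have neq0 j : 0 < j < m -> (j%:R : 'Z_m)%R != 0%R by apply: natr_Zp_neq0.
have n0_k : (k%:R : 'Z_m)%R != 0%R by apply: neq0; lia.
have n0_k1 : (k%:R + 1 : 'Z_m)%R != 0%R by rewrite natr1; apply: neq0; lia.
have n0_k2 : (k%:R + 2%:R : 'Z_m)%R != 0%R by rewrite -natrD; apply: neq0; lia.
have n0_1 : (1 : 'Z_m)%R != 0%R by apply: (neq0 1%N); lia.
have n0_2 : (2%:R : 'Z_m)%R != 0%R by apply: neq0; lia.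
have n1_k : (k%:R - 1 : 'Z_m)%R != 0%R.
  by have := neq0 k.-1; rewrite -subn1 natrB ?(ltnW k_gt1) //; apply; lia.
have neq (u v w : 'Z_m) : w != 0%R -> (u - v)%R = w -> (u == v) = false.
  by move=> w0 eq_w; apply: contraNF w0; rewrite -eq_w subr_eq0.
have neq' (u v w : 'Z_m) : w != 0%R -> (v - u)%R = w -> (u == v) = false.
  by move=> w0 eq_w; rewrite [LHS]eq_sym (neq v u w).
have := @locally_power n r xs m k%:R%R m_gt1 xsm.
rewrite unitZpE // => /(_ co_mk)[].
  rewrite /pair_vec.
  rewrite (neq' 0 k%:R _ n0_k)%R ?(neq' 0 (k%:R + 1) _ n0_k1)%R; try ring.
  rewrite (neq' 1 k%:R _ n1_k)%R ?(neq' 1 (k%:R + 1) _ n0_k)%R; try ring.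
  rewrite eqxx (neq' k%:R (k%:R + 1) _ n0_1)%R; try ring.
  rewrite (neq (k%:R + 2%:R) k%:R _ n0_2)%R; try ring.
  rewrite (neq (k%:R + 2%:R) (k%:R + 1) _ n0_1)%R; try ring.
  rewrite (neq (k%:R + k%:R + 1) k%:R _ n0_k1)%R; try ring.
  rewrite (neq (k%:R + k%:R + 1) (k%:R + 1) _ n0_k)%R; try ring.
  rewrite (neq (k%:R + k%:R + 2%:R) k%:R _ n0_k2)%R; try ring.
  rewrite (neq (k%:R + k%:R + 2%:R) (k%:R + 1) _ n0_k1)%R; try ring.
  by rewrite !(add0r, addr0).
move=> lab [lab_inj t_lab [h [Eh Ah hP]]]; exists h; split=> // s /hP[s_lab Nrs].
split=> //; apply: (separated_commute lab_inj (l := 0%R) t_lab s_lab) => [l|].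
  by rewrite -!addrA [(1 + _)%R]addrC.
by rewrite !add0r (neq' _ _ _ n1_k).
Qed.

(** For [m = 2 h] the multiplier is the odd one among [h + 1] and [h + 2]; for
    [m = 6] the units are 1 and 5, and both are excluded. *)
Lemma exists_multiplier m : 4 < m -> m != 6 ->
  exists k, [/\ 1 < k, k.+2 < m & coprime m k].
Proof.
move=> m_gt4 m_n6.
have [odd_m | even_m] := boolP (odd m).
  by exists 2; rewrite coprimen2; split=> //; lia.
have coprime_half h d : odd (h + d) -> coprime h d -> coprime (h.*2) (h + d).
  by move=> odd_hd co_hd; rewrite -muln2 coprimeMl coprime2n odd_hd andbT
    -coprime_modr modnDl coprime_modr.
set h := m./2; have def_m : m = h.*2 by rewrite /h; lia.
have [odd_h | even_h] := boolP (odd h).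
  exists (h + 2)%N; rewrite {2}def_m.
  by split; [lia | lia | apply: coprime_half; rewrite ?coprimen2 ?oddD ?odd_h].
exists (h + 1)%N; rewrite {2}def_m.
by split; [lia | lia | apply: coprime_half; rewrite ?coprimen1 ?oddD ?(negPf even_h)].
Qed.

Lemma type_D_pair_long xs m : cycle_reps t xs [:: m] -> 4 < m ->
  locally (@type_D_pair _) r (region t xs).
Proof.
move=> xsm m_gt4; have [m6 | m_n6] := eqVneq m 6.
  by apply: type_D_pair6; rewrite m6 in xsm.
have [k [k_gt1 lt_km co_mk]] := exists_multiplier m_gt4 m_n6.
exact: type_D_pair_unit xsm k_gt1 lt_km co_mk.
Qed.

End Long.

(** * Selecting and counting cycles *)

Section Selection.
Variables (n : nat) (t : 'S_n).
Implicit Types (xs : seq 'I_n) (ks : seq nat).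

Lemma extend_reps xs ks k : cycle_reps t xs ks -> count_mem k ks < ncycles t k ->
  exists x, cycle_reps t (x :: xs) (k :: ks).
Proof.
case=> <- Uxs; rewrite /ncycles => lt_k.
pose B := [seq C : {set 'I_n} <- map (porbit t) xs | #|C| == k].
have sizeB : size B = count_mem k (map (fun x => #|porbit t x|) xs).
  by rewrite size_filter !count_map.
have /subsetPn[C] : ~~ ([set C in porbits t | #|C| == k] \subset B).
  apply: contraL lt_k => /subset_leq_card le_AB.
  by rewrite -leqNgt (leq_trans le_AB) // -sizeB card_size.
rewrite inE mem_filter => /andP[/imsetP[x _ ->] /eqP xk].
rewrite xk eqxx /= => x_xs.
by exists x; rewrite /cycle_reps /= x_xs xk.
Qed.

(** Prescribing [ys] is for cycles that their lengths do not determine, such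
    as two fixed points with different signs. *)
Lemma extend_reps_cat ys ls ks : cycle_reps t ys ls ->
    (forall k, count_mem k (ks ++ ls) <= ncycles t k) ->
  exists2 xs, cycle_reps t xs ks & uniq (map (porbit t) (xs ++ ys)).
Proof.
case=> ys_ls Uys; elim: ks => [|k ks IH] le_ks; first by exists [::].
have [|xs [xs_ks _] Uxs] := IH.
  by move=> j; apply: leq_trans (le_ks j); apply: leq_addl.
have [||x [[xk _] Ux]] := @extend_reps (xs ++ ys) (ks ++ ls) k.
- by rewrite /cycle_reps map_cat xs_ks ys_ls.
- by apply: leq_trans (le_ks k); rewrite /= eqxx.
exists (x :: xs) => //; split; first by rewrite /= xk xs_ks.
by move: Ux; rewrite -cat_cons map_cat cat_uniq => /and3P[].
Qed.

Lemma exists_reps ks : (forall k, count_mem k ks <= ncycles t k) ->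
  exists xs, cycle_reps t xs ks.
Proof.
move=> le_ks; have [||xs xsP _] := @extend_reps_cat [::] [::] ks => //.
  by rewrite cats0.
by exists xs.
Qed.

End Selection.

Section Census.
Variables (n : nat) (t : 'S_n).

Lemma porbit_fixed x : t x = x -> porbit t x = [set x].
Proof.
move=> tx; apply/setP=> y; rewrite inE; apply/porbitP/eqP=> [[i ->] | ->].
  by elim: i => [|i IH]; rewrite ?perm1 // expgS permM tx.
by exists 0; rewrite perm1.
Qed.

Lemma fixed_reps x y : t x = x -> t y = y -> x != y ->
  cycle_reps t [:: x; y] [:: 1; 1]%N.
Proof.
move=> tx ty neq_xy; split; rewrite /= !porbit_fixed // ?cards1 //.
by rewrite inE (inj_eq set1_inj) neq_xy.
Qed.

Lemma sum_ncycles N : (forall x, #|porbit t x| < N) ->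
  (\sum_(k < N) k * ncycles t k = n)%N.
Proof.
move=> ltN; transitivity (\sum_(C in porbits t) #|C|).
  transitivity (\sum_(k < N) \sum_(C in [set C in porbits t | #|C| == k]) #|C|)%N.
    apply: eq_bigr => k _; rewrite mulnC -sum_nat_const.
    by apply: eq_bigr => C; rewrite inE => /andP[_ /eqP].
  rewrite (exchange_big_dep (mem (porbits t))) /=; last first.
    by move=> k C _; rewrite inE => /andP[].
  apply: eq_bigr => _ /imsetP[x _ ->].
  rewrite (bigD1 (Ordinal (ltN x))) ?inE ?imset_f ?eqxx //=.
  rewrite big1 ?addn0 // => k /andP[]; rewrite inE => /andP[_ /eqP xk].
  by case/eqP; apply: val_inj.
rewrite -[RHS]card_ord -sum1_card (partition_big_imset (porbit t)) /=.
apply: eq_bigr => _ /imsetP[x _ ->]; rewrite -sum1_card.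
by apply: eq_bigl => y; rewrite eq_porbit_mem.
Qed.

Lemma ncycles0 : ncycles t 0 = 0%N.
Proof.
apply/eqP; rewrite cards_eq0; apply/eqP/setP=> C; rewrite !inE.
by apply/negP=> /andP[/imsetP[x _ ->]]; rewrite (negPf (card_porbit_neq0 t x)).
Qed.

Lemma count_le_ncycles ks :
  all (fun k => count_mem k ks <= ncycles t k) ks ->
  forall k, count_mem k ks <= ncycles t k.
Proof.
move=> /allP ks_le k; have [/ks_le // | /count_memPn -> //] := boolP (k \in ks).
Qed.

End Census.

(** * Constraints on the numbers of cycles *)

Section Combine.
Variables (n : nat) (r : wreath n).
Local Notation t := r.2.

Lemma type_D_pair_combine xs ys : uniq (map (porbit t) (xs ++ ys)) ->
    locally (@separated _) r (region t xs) ->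
    locally (@unbraided _) r (region t ys) ->
  exists2 s, s \in r ^: even_wreath n & type_D_pair r s.
Proof.
move=> /region_disjoint; apply: locally_combine => i; exact: region_stable.
Qed.

Lemma type_D_pair_of_cycles ks ls :
    (forall xs, cycle_reps t xs ks -> locally (@separated _) r (region t xs)) ->
    (forall ys, cycle_reps t ys ls -> locally (@unbraided _) r (region t ys)) ->
    all (fun k => count_mem k (ks ++ ls) <= ncycles t k) (ks ++ ls) ->
  exists2 s, s \in r ^: even_wreath n & type_D_pair r s.
Proof.
move=> sep unb /count_le_ncycles le_ks.
have [|ys ysP] := @exists_reps n t ls.
  move=> k; apply: leq_trans (le_ks k); rewrite count_cat; exact: leq_addl.
have [xs xsP Uxys] := extend_reps_cat ysP le_ks.
exact: type_D_pair_combine Uxys (sep _ xsP) (unb _ ysP).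
Qed.

Lemma type_D_pair_local ks :
    (forall xs, cycle_reps t xs ks -> locally (@type_D_pair _) r (region t xs)) ->
    all (fun k => count_mem k ks <= ncycles t k) ks ->
  exists2 s, s \in r ^: even_wreath n & type_D_pair r s.
Proof.
by move=> pairP /count_le_ncycles /exists_reps[xs /pairP /locally_class].
Qed.

Hypothesis no_pair : forall s, s \in r ^: even_wreath n -> ~ type_D_pair r s.

(* The next two facts are contrapositives: each configuration treated above
   forbids some numbers of cycles. *)
Let no_pair_local ks :
  (forall xs, cycle_reps t xs ks -> locally (@type_D_pair _) r (region t xs)) ->
  ~ all (fun k => count_mem k ks <= ncycles t k) ks.
Proof. by move=> /type_D_pair_local ksP /ksP[s /no_pair]. Qed.

Let no_pair_of_cycles ks ls :
  (forall xs, cycle_reps t xs ks -> locally (@separated _) r (region t xs)) ->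
  (forall ys, cycle_reps t ys ls -> locally (@unbraided _) r (region t ys)) ->
  ~ all (fun k => count_mem k (ks ++ ls) <= ncycles t k) (ks ++ ls).
Proof. by move=> /type_D_pair_of_cycles sep /sep unb /unb[s /no_pair]. Qed.

Let sep_cycle m : 2 < m -> forall xs, cycle_reps t xs [:: m] ->
  locally (@separated _) r (region t xs).
Proof. by move=> m_gt2 xs; apply: separated_cycle. Qed.

Lemma no_long_cycle m : 4 < m -> ncycles t m = 0%N.
Proof.
move=> m_gt4; apply/eqP; rewrite -leqn0 leqNgt; apply/negP=> m_pos.
apply: (@no_pair_local [:: m]) => [xs xsm | ]; first exact: type_D_pair_long xsm m_gt4.
by rewrite /= eqxx addn0 andbT.
Qed.

Lemma three_cycle_counts : 0 < ncycles t 3 ->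
  [/\ ncycles t 3 = 1%N, ncycles t 4 = 0%N, ncycles t 2 < 2 &
      (ncycles t 1 == 0) || (ncycles t 2 == 0)]%N.
Proof.
move=> c3; have := no_pair_of_cycles (sep_cycle (isT : 2 < 3)) (@unbraided3 n r).
have := no_pair_of_cycles (sep_cycle (isT : 2 < 4)) (@unbraided3 n r).
have := no_pair_of_cycles (@separated22 n r) (@unbraided3 n r).
have := no_pair_of_cycles (sep_cycle (isT : 2 < 3)) (@unbraided21 n r).
rewrite /= => *; split; lia.
Qed.

Lemma four_cycle_counts : 0 < ncycles t 4 ->
  [/\ ncycles t 1 = 0%N, ncycles t 2 = 0%N, ncycles t 3 = 0%N & ncycles t 4 = 1%N].
Proof.
move=> c4; have := no_pair_of_cycles (sep_cycle (isT : 2 < 4)) (@unbraided4 n r).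
have := no_pair_of_cycles (sep_cycle (isT : 2 < 4)) (@unbraided3 n r).
have := no_pair_local (@type_D_pair41 n r).
have := no_pair_local (@type_D_pair24 n r).
rewrite /= => *; split; lia.
Qed.

Lemma two_cycle_counts :
  [/\ ncycles t 2 < 5, (1 < ncycles t 2) ==> (ncycles t 1 < 3) &
      (2 < ncycles t 2) ==> (ncycles t 1 == 0)]%N.
Proof.
have := no_pair_of_cycles (@separated22 n r) (@unbraided222 n r).
have := no_pair_of_cycles (@separated211 n r) (@unbraided21 n r).
have := no_pair_of_cycles (@separated22 n r) (@unbraided21 n r).
rewrite /= => *; split; lia.
Qed.

(** Two fixed points with different signs separate, and cycles [ks] disjoint
    from them give the inequality. *)
Lemma fixed_points_constant ks i j : (forall ys, cycle_reps t ys ks ->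
    locally (@unbraided _) r (region t ys)) ->
    all (fun k => count_mem k (ks ++ [:: 1; 1]%N) <= ncycles t k)
      (ks ++ [:: 1; 1]%N) ->
  t i = i -> t j = j -> r.1 i = r.1 j.
Proof.
move=> unb le_ks ti tj; apply/eqP/negPn/negP=> neq_ij.
have ij : i != j by apply: contraNneq neq_ij => ->.
have [ys ysP Uys] := extend_reps_cat (fixed_reps ti tj ij) (count_le_ncycles le_ks).
have [] : exists2 s, s \in r ^: even_wreath n & type_D_pair r s.
  apply: (@type_D_pair_combine [:: i; j] ys).
  - by rewrite map_cat uniq_catC -map_cat.
  - exact: separated_fixed ti tj neq_ij.
  - exact: unb.
by move=> s /no_pair.
Qed.

End Combine.

Lemma not_type_D_no_pair (n : nat) (G : {group wreath n}) (r s : wreath n) :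
    even_wreath n \subset G -> r \in G ->
    ~ type_D (@conj_op (wreath n)) (r ^: G) ->
  s \in r ^: even_wreath n -> ~ type_D_pair r s.
Proof.
move=> EG Gr notD rs pair_rs; apply: notD.
apply: type_D_class Gr (class_refl _ _) _ pair_rs.
exact: subsetP (classS r EG) s rs.
Qed.

Local Close Scope group_scope.

Theorem theorem3p7 (n : nat) (hn : 4 < n)
    (G : {group wreath n})
    (hG : G = [set: wreath n]%G \/ G = even_wreath_group n)
    (t : 'S_n) (ht : t <> 1%g) (a : vec2 n)
    (hG_at : ((a, t) : wreath n) \in G)
    (hD : ~ type_D (@conj_op (wreath n)) (((a, t) : wreath n) ^: G)%g) :
  [\/ has_type t [:: (2, 1); (3, 1)] \/ has_type t [:: (2, 3)],
      [\/ has_type t [:: (2, 4)],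
          has_type t [:: (1, 1); (2, 2)],
          has_type t [:: (1, 2); (3, 1)] |
          has_type t [:: (1, 2); (2, 2)]] |
      (has_type t [:: (1, n - 2); (2, 1)] \/
       has_type t [:: (1, n - 3); (3, 1)] /\ 5 < n) /\
      (forall i j : 'I_n, t i = i -> t j = j -> a i = a j)].
Proof.
have EG : even_wreath n \subset G.
  by case: hG => ->; rewrite ?subsetT.
have no_pair s := @not_type_D_no_pair n G (a, t) s EG hG_at hD.
have c_big k : 4 < k -> ncycles t k = 0 by apply: no_long_cycle no_pair k.
have c_pos x : 0 < ncycles t #|porbit t x|.
  by apply/card_gt0P; exists (porbit t x); rewrite inE imset_f ?eqxx.
have small x : #|porbit t x| < 5.
  by rewrite ltnNge; apply/negP=> /c_big; have := c_pos x; lia.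
have := sum_ncycles small; rewrite !big_ord_recr big_ord0 /= !mul0n mul1n => sum_n.
have c4 : ncycles t 4 = 0.
  apply/eqP; rewrite -leqn0 leqNgt; apply/negP.
  by move=> /(four_cycle_counts no_pair)[] /=; lia.
have c23 : 0 < ncycles t 2 + ncycles t 3.
  rewrite lt0n; apply: contra_notN ht => /eqP c23; apply/permP=> x; rewrite perm1.
  have := porbit_id t x; have := mem_porbit t 1 x; rewrite expg1.
  have /eqP/cards1P[y ->] : #|porbit t x| = 1.
    have := c_pos x; have := small x; have := card_porbit_neq0 t x.
    case: #|porbit t x| => [|[|[|[|[|k]]]]] //; rewrite ?c4 //; lia.
  by rewrite !inE => /eqP -> /eqP ->.
have type_eq ts : ncycles t 1 = \sum_(p <- ts | p.1 == 1) p.2 ->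
    ncycles t 2 = \sum_(p <- ts | p.1 == 2) p.2 ->
    ncycles t 3 = \sum_(p <- ts | p.1 == 3) p.2 ->
    all (fun p => 0 < p.1 < 4) ts -> has_type t ts.
  move=> e1 e2 e3 /allP ts_small k.
  have [k_small | k_big] := boolP (0 < k < 4).
    by case: k k_small => [|[|[|[|]]]].
  rewrite big1_seq => [|[l c] /andP[/= /eqP lk /ts_small]]; last first.
    by rewrite /= lk (negPf k_big).
  by case: k k_big => [|[|[|[|[|k]]]]] // _; rewrite ?ncycles0 ?c_big.
have /= [c2_lt5 c2_c1 c2_c1'] := two_cycle_counts no_pair.
have [c3_0 | c3_pos] := posnP (ncycles t 3); last first.
  have /= [c3_1 _ c2_lt2 c12] := three_cycle_counts no_pair c3_pos.
  have [c2_0 | c2_pos] := posnP (ncycles t 2); last first.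
    apply: Or31; left; apply: type_eq => //; rewrite unlock /=; lia.
  have [n5 | n_n5] := eqVneq n 5.
    apply: Or32; apply: Or43; apply: type_eq => //; rewrite unlock /=; lia.
  apply: Or33; split.
    right; split; [apply: type_eq => //; rewrite unlock /=; lia | lia].
  move=> i j; apply: (fixed_points_constant no_pair (@unbraided3 n _)).
  by rewrite /=; lia.
have [c2_1 | c2_n1] := eqVneq (ncycles t 2) 1.
  apply: Or33; split; first by left; apply: type_eq => //; rewrite unlock /=; lia.
  move=> i j; apply: (fixed_points_constant no_pair (@unbraided21 n _)).
  by rewrite /=; lia.
have [c2_2 | c2_n2] := eqVneq (ncycles t 2) 2.
  have [c1_1 | c1_n1] := eqVneq (ncycles t 1) 1.
    by apply: Or32; apply: Or42; apply: type_eq => //; rewrite unlock /=; lia.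
  by apply: Or32; apply: Or44; apply: type_eq => //; rewrite unlock /=; lia.
have [c2_3 | c2_n3] := eqVneq (ncycles t 2) 3.
  by apply: Or31; right; apply: type_eq => //; rewrite unlock /=; lia.
by apply: Or32; apply: Or41; apply: type_eq => //; rewrite unlock /=; lia.
Qed.
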